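(* Let $(M,H)$ be a Hamilton space with Hamiltonian vector field $\rho_H$. If $\widetilde{X}$ is a vector field on $M$ such that the 1-form $\mathcal{L}_{\widetilde{X}^{C*}}\theta$ is closed and $d(\widetilde{X}^{C*}(H))=0$, then $\widetilde{X}$ is a natural infinitesimal symmetry, i.e. $[\rho_H,\widetilde{X}^{C*}]=0$.
   Context: Hamilton space: $M$ is a smooth $n$-dimensional manifold and $H:T^{*}M\to\mathbb{R}$ is smooth on $T^{*}M\setminus\{0\}$ (zero section removed), continuous on the zero section, with $g^{ij}=\frac{\partial^2H}{\partial p_i\partial p_j}$ of rank $n$ and constant signature on $T^{*}M\setminus\{0\}$, in induced coordinates $(x^i,p_i)$. All structures are considered on $T^{*}M\setminus\{0\}$. $\theta=p_i\,dx^i$ is the Liouville 1-form and $\omega=d\theta=dp_i\wedge dx^i$ the canonical symplectic form. The Hamiltonian vector field $\rho_H=\frac{\partial H}{\partial p_i}\frac{\partial}{\partial x^i}-\frac{\partial H}{\partial x^i}\frac{\partial}{\partial p_i}$ is determined by $i_{\rho_H}\omega=-dH$. For $\widetilde{X}=\widetilde{X}^i(x)\frac{\partial}{\partial x^i}\in\mathcal{X}(M)$, its complete lift to $T^{*}M$ is $\widetilde{X}^{C*}=\widetilde{X}^i\frac{\partial}{\partial x^i}-p_j\frac{\partial\widetilde{X}^j}{\partial x^i}\frac{\partial}{\partial p_i}$. A natural infinitesimal symmetry is a vector field $\widetilde{X}\in\mathcal{X}(M)$ with $[\rho_H,\widetilde{X}^{C*}]=0$. *)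

(* Defs.v *)
From HB Require Import structures.
From mathcomp Require Import all_boot all_order all_algebra.
From mathcomp Require Import all_classical all_reals all_analysis.

Set Implicit Arguments.
Unset Strict Implicit.
Unset Printing Implicit Defensive.

Import Order.TTheory GRing.Theory Num.Theory.
Import numFieldNormedType.Exports.

Local Open Scope classical_set_scope.
Local Open Scope ring_scope.

Section Smooth.
Context {R : realType} {V W : normedModType R}.

(* For finite-dimensional V this is C^k on the open set U: a map is C^(k+1)
   iff it is differentiable and all its directional derivatives are C^k. *)
Fixpoint Ck (k : nat) (U : set V) (f : V -> W) : Prop :=
  if k is k'.+1 then
    (forall x, U x -> differentiable f x) /\ (forall v, Ck k' U ('D_v f))
  else forall x, U x -> {for x, continuous f}.

Definition smooth (U : set V) (f : V -> W) := forall k, Ck k U f.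

End Smooth.

Section Jacobian.
Context {R : realType}.

Lemma near_eq_jacobian m n (f g : 'rV[R]_m -> 'rV[R]_n) (u : 'rV[R]_m) :
  differentiable f u -> differentiable g u -> {near u, f =1 g} ->
  'J f u = 'J g u.
Proof.
move=> df dg fg; apply/row_matrixP => r.
rewrite [LHS]rowE [RHS]rowE.
have Df := deriveEjacobian (delta_mx 0 r) df.
have Dg := deriveEjacobian (delta_mx 0 r) dg.
apply: etrans (esym Df) _; apply: etrans _ Dg.
have [->|v0] := eqVneq (delta_mx 0 r : 'rV[R]_m) 0; first by rewrite !derive0.
exact: near_eq_derive.
Qed.

Lemma jacobian_comp m n p (f : 'rV[R]_m -> 'rV[R]_n) (g : 'rV[R]_n -> 'rV[R]_p)
    (u : 'rV[R]_m) :
  differentiable f u -> differentiable g (f u) ->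
  'J (g \o f) u = 'J f u *m 'J g (f u).
Proof.
move=> df dg; have dgf := differentiable_comp df dg.
apply/row_matrixP => r; rewrite [LHS]rowE [RHS]rowE mulmxA.
set v := delta_mx 0 r.
have Df := deriveEjacobian v df.
apply: etrans (esym (deriveEjacobian v dgf)) _.
rewrite -Df; apply: etrans _ (deriveEjacobian _ dg).
rewrite [LHS](deriveE _ dgf) [RHS](deriveE _ dg) (deriveE _ df).
by rewrite (diff_comp df dg).
Qed.

Lemma jacobian_id m (u : 'rV[R]_m) : 'J id u = 1%:M.
Proof.
apply/row_matrixP => r; rewrite [LHS]rowE [RHS]rowE mulmx1.
have did : differentiable (id : 'rV[R]_m -> 'rV[R]_m) u by [].
by apply: etrans (esym (deriveEjacobian _ did)) _; rewrite derive_id.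
Qed.

End Jacobian.

(* Tensor calculus in coordinates on R^m.  A vector field and a 1-form are both
   given by the row of their components. *)
Section LocalCalculus.
Context {R : realType} {m : nat}.
Implicit Types (f : 'rV[R]_m -> R) (V W a : 'rV[R]_m -> 'rV[R]_m).

Definition pderiv (i : 'I_m) f (z : 'rV[R]_m) : R := 'D_(delta_mx 0 i) f z.

Definition vf_apply V f (z : 'rV[R]_m) : R := \sum_i V z 0 i * pderiv i f z.

Definition lie_bracket V W (z : 'rV[R]_m) : 'rV[R]_m :=
  \row_i (vf_apply V (fun y => W y 0 i) z - vf_apply W (fun y => V y 0 i) z).

Definition ext_d0 f (z : 'rV[R]_m) : 'rV[R]_m := \row_i pderiv i f z.

(* (d a)(@_i, @_j) = @_i a_j - @_j a_i, without the factor 1/2. *)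
Definition ext_d1 a (z : 'rV[R]_m) : 'M[R]_m :=
  \matrix_(i, j) (pderiv i (fun y => a y 0 j) z - pderiv j (fun y => a y 0 i) z).

Definition lie_derivative1 V a (z : 'rV[R]_m) : 'rV[R]_m :=
  \row_i \sum_j (V z 0 j * pderiv j (fun y => a y 0 i) z
                 + a z 0 j * pderiv i (fun y => V y 0 j) z).

End LocalCalculus.

(* Canonical structures of T*R^n.  A point (x, p) is the row z = row_mx x p, so
   that x = lsubmx z, p = rsubmx z; coordinate x^i has index lshift n i and
   coordinate p_i has index rshift n i. *)
Section PhaseSpace.
Context {R : realType} {n : nat}.
Implicit Types (h : 'rV[R]_(n + n) -> R) (z : 'rV[R]_(n + n)).

Definition liouville z : 'rV[R]_(n + n) := row_mx (rsubmx z) 0.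

Definition hamiltonian_vf h z : 'rV[R]_(n + n) :=
  row_mx (\row_i pderiv (rshift n i) h z) (\row_i - pderiv (lshift n i) h z).

Definition complete_lift (X : 'rV[R]_n -> 'rV[R]_n) z : 'rV[R]_(n + n) :=
  row_mx (X (lsubmx z))
    (\row_i - \sum_j rsubmx z 0 j * pderiv i (fun x => X x 0 j) (lsubmx z)).

Definition fiber_hessian h z : 'M[R]_n :=
  \matrix_(i, j) pderiv (rshift n i) (pderiv (rshift n j) h) z.

(* Sylvester normal form with p ones, q minus ones, and n - p - q zeros. *)
Definition has_signature (p q : nat) (A : 'M[R]_n) : Prop :=
  (p + q <= n)%N /\
  exists2 P : 'M[R]_n, P \in unitmx &
    P *m A *m P^T =
    diag_mx (\row_(i < n) if (i < p)%N then 1 else if (i < p + q)%N then -1 else 0).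

Lemma hamiltonian_vfP h z :
  hamiltonian_vf h z *m ext_d1 liouville z = - ext_d0 h z.
Proof.
have pcst i (c : R) : pderiv i (fun=> c) z = 0 by exact: derive_cst.
have pcoord i (k : 'I_(n + n)) : pderiv i (fun y => y 0 k) z = (i == k)%:R.
  have := derive_mx (@derivable_id _ _ z (delta_mx 0 i : 'rV[R]_(n + n))).
  rewrite derive_id => /(congr1 (fun A : 'rV[R]_(n + n) => A 0 k)).
  by rewrite !mxE eqxx eq_sym => ->.
have lL i k : pderiv i (fun y => liouville y 0 (lshift n k)) z
    = (i == rshift n k)%:R.
  rewrite -pcoord; congr pderiv; apply/funext => y.
  by rewrite /liouville row_mxEl mxE.
have lR i k : pderiv i (fun y => liouville y 0 (rshift n k)) z = 0.
  rewrite -[RHS](pcst i 0); congr pderiv; apply/funext => y.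
  by rewrite /liouville row_mxEr mxE.
apply/rowP => j; rewrite !mxE big_split_ord/=.
case: (split_ordP j) => k ->.
- rewrite big1 ?add0r => [|i _]; last first.
    by rewrite !mxE !lL eq_lrshift eq_lrshift subrr mulr0.
  rewrite (bigD1 k)//= big1 ?addr0 => [|i ik].
    by rewrite row_mxEr !mxE lL lR eqxx subr0 mulr1.
  by rewrite !mxE lL lR eq_rshift (negbTE ik) subr0 mulr0.
- rewrite [X in _ + X]big1 ?addr0 => [|i _]; last first.
    by rewrite !mxE !lR subrr mulr0.
  rewrite (bigD1 k)//= big1 ?addr0 => [|i ik].
    by rewrite row_mxEl !mxE lL lR eqxx sub0r mulrN1.
  by rewrite !mxE lL lR eq_rshift eq_sym (negbTE ik) subr0 mulr0.
Qed.

End PhaseSpace.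

(* chart_inv is meaningful only on chart_cod. *)
Record chart (R : realType) (M : topologicalType) (n : nat) := Chart {
  chart_dom : set M;
  chart_map : M -> 'rV[R]_n;
  chart_inv : 'rV[R]_n -> M;
  chart_dom_open : open chart_dom;
  chart_cod_open : open (chart_map @` chart_dom);
  chart_mapK : forall x, chart_dom x -> chart_inv (chart_map x) = x;
  chart_map_cont : forall x, chart_dom x -> {for x, continuous chart_map};
  chart_inv_cont :
    forall u, (chart_map @` chart_dom) u -> {for u, continuous chart_inv} }.

Definition chart_cod (R : realType) (M : topologicalType) (n : nat)
  (c : chart R M n) : set 'rV[R]_n := chart_map c @` chart_dom c.

Definition transition (R : realType) (M : topologicalType) (n : nat)
  (c c' : chart R M n) : 'rV[R]_n -> 'rV[R]_n := chart_map c' \o chart_inv c.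

Record manifold (R : realType) (n : nat) := Manifold {
  carrier :> topologicalType;
  carrier_hausdorff : hausdorff_space carrier;
  carrier_second_countable : @second_countable carrier;
  atlas_index : Type;
  atlas : atlas_index -> chart R carrier n;
  atlas_cover : forall x, exists i, chart_dom (atlas i) x;
  atlas_compat : forall i j,
    smooth (chart_map (atlas i) @` (chart_dom (atlas i) `&` chart_dom (atlas j)))
           (transition (atlas i) (atlas j)) }.

Section Bundles.
Context {R : realType} {n : nat} {M : manifold R n}.
Local Notation A := (@atlas R n M).
Local Notation I := (@atlas_index R n M).

(* A tangent (cotangent) vector at x is the family of its components in the
   charts around x, subject to the contravariant (covariant) transformation law.
   Components in the charts that miss x are set to 0.  The row convention of
   'J makes ('J f u) i j the derivative of f^j along the i-th coordinate. *)
Record tangent (x : M) := Tangent {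
  tcomp : I -> 'rV[R]_n;
  tcomp_law : forall i j, chart_dom (A i) x -> chart_dom (A j) x ->
    tcomp j = tcomp i *m 'J (transition (A i) (A j)) (chart_map (A i) x);
  tcomp_out : forall i, ~ chart_dom (A i) x -> tcomp i = 0 }.

Record cotangent (x : M) := Cotangent {
  ctcomp : I -> 'rV[R]_n;
  ctcomp_law : forall i j, chart_dom (A i) x -> chart_dom (A j) x ->
    ctcomp i = ctcomp j *m ('J (transition (A i) (A j)) (chart_map (A i) x))^T;
  ctcomp_out : forall i, ~ chart_dom (A i) x -> ctcomp i = 0 }.

Lemma chart_overlap_open (i j : I) :
  open (chart_map (A i) @` (chart_dom (A i) `&` chart_dom (A j))).
Proof.
rewrite openE => _ [x [xi xj] <-].
have cx : chart_cod (A i) (chart_map (A i) x) by exists x.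
have n1 : nbhs (chart_map (A i) x) (chart_cod (A i)).
  by apply: open_nbhs_nbhs; split; first exact: chart_cod_open.
have n2 : nbhs (chart_map (A i) x) (chart_inv (A i) @^-1` chart_dom (A j)).
  apply: (chart_inv_cont cx); rewrite chart_mapK//.
  by apply: open_nbhs_nbhs; split; first exact: chart_dom_open.
apply: filterS (filterI n1 n2) => _ [[y yi <-]].
by rewrite /preimage/= chart_mapK// => yj; exists y.
Qed.

Lemma transition_diff (i j : I) (x : M) :
  chart_dom (A i) x -> chart_dom (A j) x ->
  differentiable (transition (A i) (A j)) (chart_map (A i) x).
Proof.
by move=> xi xj; have [+ _] := atlas_compat i j 1%N; apply; exists x.
Qed.

Lemma transition_jacobianM (i j k : I) (x : M) :
  chart_dom (A i) x -> chart_dom (A j) x -> chart_dom (A k) x ->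
  'J (transition (A i) (A k)) (chart_map (A i) x) =
  'J (transition (A i) (A j)) (chart_map (A i) x) *m
  'J (transition (A j) (A k)) (chart_map (A j) x).
Proof.
move=> xi xj xk; set u := chart_map (A i) x.
have tu : transition (A i) (A j) u = chart_map (A j) x.
  by rewrite /transition/= chart_mapK.
have dij := transition_diff xi xj; have dik := transition_diff xi xk.
have djk := transition_diff xj xk; rewrite -tu in djk.
have eqn : {near u, transition (A i) (A k) =1
    transition (A j) (A k) \o transition (A i) (A j)}.
  have : nbhs u (chart_map (A i) @` (chart_dom (A i) `&` chart_dom (A j))).
    apply: open_nbhs_nbhs; split; first exact: chart_overlap_open.
    by exists x.
  by apply: filterS => _ [y [yi yj] <-]; rewrite /transition/= !chart_mapK.
rewrite -tu -(jacobian_comp dij djk); apply: near_eq_jacobian => //.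
exact: differentiable_comp.
Qed.

Lemma transition_jacobianxx (i : I) (x : M) : chart_dom (A i) x ->
  'J (transition (A i) (A i)) (chart_map (A i) x) = 1%:M.
Proof.
move=> xi; rewrite -(jacobian_id (chart_map (A i) x)).
apply: near_eq_jacobian; [exact: transition_diff|by []|].
have : nbhs (chart_map (A i) x) (chart_cod (A i)).
  apply: open_nbhs_nbhs; split; first exact: chart_cod_open.
  by exists x.
by apply: filterS => _ [y yi <-]; rewrite /transition/= chart_mapK.
Qed.

Section InducedChart.
Variables (i : I) (x : M) (p : 'rV[R]_n).

Definition covector_comp (j : I) : 'rV[R]_n :=
  if `[< chart_dom (A i) x /\ chart_dom (A j) x >] then
    p *m ('J (transition (A j) (A i)) (chart_map (A j) x))^T
  else 0.

Fact covector_law (j k : I) : chart_dom (A j) x -> chart_dom (A k) x ->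
  covector_comp j =
  covector_comp k *m ('J (transition (A j) (A k)) (chart_map (A j) x))^T.
Proof.
move=> xj xk; rewrite /covector_comp.
have [xi|xi] := pselect (chart_dom (A i) x); last first.
  by rewrite !asboolF ?mul0mx// => -[].
rewrite (asboolT (conj xi xj)) (asboolT (conj xi xk)).
apply: etrans _ (mulmxA _ _ _); congr (p *m _).
apply: etrans _ (trmx_mul _ _); congr (_^T).
exact: transition_jacobianM.
Qed.

Fact covector_out (j : I) : ~ chart_dom (A j) x -> covector_comp j = 0.
Proof. by move=> xj; rewrite /covector_comp asboolF// => -[]. Qed.

(* p_k dx^k at x, in the coordinates of the chart i. *)
Definition covector : cotangent x := Cotangent covector_law covector_out.

Lemma covectorE : chart_dom (A i) x -> ctcomp covector i = p.
Proof.
move=> xi; rewrite /= /covector_comp (asboolT (conj xi xi)).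
have -> := transition_jacobianxx xi; by rewrite trmx1 mulmx1.
Qed.

End InducedChart.

Definition cotangent_bundle := {x : M & cotangent x}.

(* Inverse of the induced chart (x^i, p_i) of T*M. *)
Definition induced_inv (i : I) (z : 'rV[R]_(n + n)) : cotangent_bundle :=
  existT _ (chart_inv (A i) (lsubmx z))
    (covector i (chart_inv (A i) (lsubmx z)) (rsubmx z)).

(* Image of T*M minus the zero section under the induced chart. *)
Definition slit_dom (i : I) : set 'rV[R]_(n + n) :=
  [set z | chart_cod (A i) (lsubmx z) /\ rsubmx z != 0].

Definition fun_coord (H : cotangent_bundle -> R) (i : I) :
  'rV[R]_(n + n) -> R := H \o induced_inv i.

Definition vf_coord (X : forall x : M, tangent x) (i : I) :
  'rV[R]_n -> 'rV[R]_n := fun u => tcomp (X (chart_inv (A i) u)) i.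

Definition smooth_vf (X : forall x : M, tangent x) : Prop :=
  forall i, smooth (chart_cod (A i)) (vf_coord X i).

Record hamilton_space (H : cotangent_bundle -> R) : Prop := HamiltonSpace {
  ham_smooth : forall i, smooth (slit_dom i) (fun_coord H i);
  ham_continuous : forall i u, chart_cod (A i) u ->
    {for row_mx u 0, continuous (fun_coord H i)};
  ham_rank : forall i z, slit_dom i z ->
    \rank (fiber_hessian (fun_coord H i) z) = n;
  ham_signature : exists p q : nat, forall i z, slit_dom i z ->
    has_signature p q (fiber_hessian (fun_coord H i) z) }.

(* Tensor fields on T*M minus the zero section, given by their components in
   the induced charts. *)
Definition rho (H : cotangent_bundle -> R) (i : I) :=
  hamiltonian_vf (fun_coord H i).

Definition clift (X : forall x : M, tangent x) (i : I) :=
  complete_lift (vf_coord X i).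

Definition vanishes (T : nmodType) (t : I -> 'rV[R]_(n + n) -> T) : Prop :=
  forall i z, slit_dom i z -> t i z = 0.

Definition closed1 (a : I -> 'rV[R]_(n + n) -> 'rV[R]_(n + n)) : Prop :=
  vanishes (fun i => ext_d1 (a i)).

Definition natural_infinitesimal_symmetry
    (H : cotangent_bundle -> R) (X : forall x : M, tangent x) : Prop :=
  vanishes (fun i => lie_bracket (rho H i) (clift X i)).

End Bundles.

Arguments tangent {R n} M x.
Arguments cotangent_bundle {R n} M.

(* Main.v *)
Require Import Defs.
From mathcomp Require Import all_boot all_order all_algebra.
From mathcomp Require Import all_classical all_reals all_analysis.
From mathcomp Require Import ring.

Set Implicit Arguments.
Unset Strict Implicit.
Unset Printing Implicit Defensive.

Import Order.TTheory GRing.Theory Num.Theory.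
Import numFieldNormedType.Exports.

Local Open Scope classical_set_scope.
Local Open Scope ring_scope.

(** The complete lift of a vector field X on M is the Hamiltonian vector field
    of the momentum function F(x, p) = p_j X^j(x) (complete_lift_hamiltonian).
    On a symplectic manifold, h |-> rho_h turns the Poisson bracket into the
    Lie bracket up to sign; in the present conventions
      [rho_h, rho_f] = - rho_(rho_f(h))
    (lie_bracket_hamiltonian_vf).  For f = F and h = H the function rho_f(h) is
    the derivative of H along the complete lift, whose differential vanishes,
    and a function with zero differential has zero Hamiltonian vector field.

    The bracket formula is the Leibniz rule together with the symmetry of the
    second derivatives of f and h, so both functions must be shown to have
    symmetric second partials.  The equality of mixed derivatives
    (derive_symmetric) is proved for maps into a normed space W, seen through a
    continuous linear functional l : W -> R: taking l to be the identity gives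
    the scalar case needed for H, and taking coordinates gives the row-valued
    case needed for X.  The second partials of F are then computed from those of
    X: differentiating F along the base gives again a momentum function, that of
    a derivative of X, and differentiating it along the fiber gives a component
    of X. *)

(** * Symmetry of mixed second derivatives *)

Section MixedDerivatives.
Context {R : realType} {V W : normedModType R}.
Implicit Types (f : V -> W) (l : {linear W -> R}) (a v w : V).

Lemma is_derive_line l f a v (s : R) : continuous l ->
  derivable f (a + s *: v) v ->
  is_derive s 1 (fun t => l (f (a + t *: v))) (l ('D_v f (a + s *: v))).
Proof.
move=> lc fd.
have E : (fun h : R => h^-1 *: (((fun t : R => f (a + t *: v)) \o shift s) h%:A
           - f (a + s *: v)))
       = (fun h : R => h^-1 *: ((f \o shift (a + s *: v)) (h *: v)
           - f (a + s *: v))).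
  apply/funext => h /=; congr (_ *: (f _ - _)).
  by rewrite [h%:A]mulr1 scalerDl addrCA.
have d1 : derivable (fun t : R => f (a + t *: v)) s 1.
  by rewrite /derivable E.
have d2 : differentiable (fun t : R => f (a + t *: v)) s.
  exact/derivable1_diffP.
have dl : differentiable l (f (a + s *: v)) by exact: linear_differentiable.
have dlf :=
  @differentiable_comp _ _ _ _ (fun t : R => f (a + t *: v)) l s d2 dl.
apply: DeriveDef; first exact: diff_derivable dlf.
rewrite (deriveE _ dlf) (diff_comp d2 dl) (diff_lin _ lc) /=.
by rewrite -(deriveE _ d2) /derive E.
Qed.

Lemma MVT_line l f a v (t : R) : continuous l -> 0 < t ->
  (forall s, s \in `[0, t]%R -> derivable f (a + s *: v) v) ->
  exists2 s, s \in `[0, t]%R &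
    l (f (a + t *: v)) - l (f a) = t * l ('D_v f (a + s *: v)).
Proof.
move=> lc t0 fd.
have dphi s : s \in `[0, t]%R ->
    is_derive s 1 (fun r => l (f (a + r *: v))) (l ('D_v f (a + s *: v))).
  by move=> st; apply: is_derive_line => //; exact: fd.
have dopen s : s \in `]0, t[%R ->
    is_derive s 1 (fun r => l (f (a + r *: v))) (l ('D_v f (a + s *: v))).
  by move=> st; apply: dphi; apply: subset_itv_oo_cc.
have cphi : {within `[0, t], continuous (fun r => l (f (a + r *: v)))}.
  by apply: derivable_within_continuous => s st; have [] := dphi s st.
have [s st E] := MVT_segment (ltW t0) dopen cphi.
exists s => //; move: E; rewrite scale0r addr0 subr0 => ->.
exact: mulrC.
Qed.

(** The mean value theorem, first for x |-> f (x + t w) - f x along v, then for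
    'D_v f along w.  The left-hand side is invariant under the exchange of v and
    w, which is what makes mixed derivatives agree. *)
Lemma second_difference l f a v w (t : R) : continuous l -> 0 < t ->
  (forall r s, r \in `[0, t]%R -> s \in `[0, t]%R ->
    derivable f (a + r *: v + s *: w) v /\
    derivable ('D_v f) (a + r *: v + s *: w) w) ->
  exists r s, [/\ r \in `[0, t]%R, s \in `[0, t]%R &
    l (f (a + t *: v + t *: w)) - l (f (a + t *: v))
      - (l (f (a + t *: w)) - l (f a))
    = t * (t * l ('D_w ('D_v f) (a + r *: v + s *: w)))].
Proof.
move=> lc t0 fd.
have i0 : 0 \in `[0, t]%R by rewrite in_itv/= lexx ltW.
have it : t \in `[0, t]%R by rewrite in_itv/= lexx ltW.
pose g := (f \o shift (t *: w)) - f.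
have shE x : (fun h : R => h^-1 *: (((f \o shift (t *: w)) \o shift x) (h *: v)
                 - (f \o shift (t *: w)) x))
           = (fun h : R => h^-1 *: ((f \o shift (x + t *: w)) (h *: v)
                 - f (x + t *: w))).
  by apply/funext => h /=; rewrite addrA.
have shD x : 'D_v (f \o shift (t *: w)) x = 'D_v f (x + t *: w).
  by rewrite /derive shE.
have dsh s : s \in `[0, t]%R ->
    derivable (f \o shift (t *: w)) (a + s *: v) v.
  by move=> st; rewrite /derivable shE; have [] := fd s t st it.
have df s : s \in `[0, t]%R -> derivable f (a + s *: v) v.
  by move=> st; have [] := fd s 0 st i0; rewrite scale0r addr0.
have [|r rt] := @MVT_line l g a v t lc t0.
  by move=> s st; apply: derivableB; [exact: dsh|exact: df].
rewrite deriveB; [|exact: dsh|exact: df].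
rewrite shD [X in _ = t * X]linearB.
have [|s st ->] := @MVT_line l ('D_v f) (a + r *: v) w t lc t0.
  by move=> s st; have [] := fd r s rt st.
move=> E; exists r, s; split=> //.
rewrite -E /g !linearB/= /shift/=; ring.
Qed.

Lemma nbhs_parallelogram a v w (N : set V) : nbhs a N ->
  exists2 t : R, 0 < t & forall r s, r \in `[0, t]%R -> s \in `[0, t]%R ->
    N (a + r *: v + s *: w).
Proof.
move=> /nbhs_ballP[e /= e0 eN].
have c0 : 0 < `|v| + `|w| + 1 by rewrite ltr_wpDl// addr_ge0.
have t0 : 0 < e / (`|v| + `|w| + 1) by rewrite divr_gt0.
exists (e / (`|v| + `|w| + 1)) => // r s; rewrite !in_itv/=.
move=> /andP[r0 rt] /andP[s0 st]; apply: eN.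
(* |r v + s w| <= t (|v| + |w|) < e for t = e / (|v| + |w| + 1); the 1 makes the
   inequality strict and the denominator nonzero. *)
rewrite -ball_normE/= -addrA opprD addNKr normrN.
apply: le_lt_trans (ler_normD _ _) _; rewrite !normrZ !ger0_norm//.
apply: (@le_lt_trans _ _ (e / (`|v| + `|w| + 1) * (`|v| + `|w|))).
  by rewrite mulrDr lerD// ler_wpM2r.
by rewrite mulrAC ltr_pdivrMr// ltr_pM2l// ltrDl.
Qed.

(** If the two mixed derivatives differed at a, continuity would keep them in
    disjoint open sets near a; but on any small parallelogram at a the second
    difference makes a value of one equal to a value of the other. *)
Lemma derive_symmetric l f (U : set V) a v w : continuous l ->
  open U -> Ck 2 U f -> U a ->
  l ('D_w ('D_v f) a) = l ('D_v ('D_w f) a).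
Proof.
move=> lc oU [fd f1] Ua; apply/eqP/negPn/negP => ne.
have cl u u' : {for a, continuous (fun x => l ('D_u' ('D_u f) x))}.
  by apply: continuous_comp; [exact: (f1 u).2|exact: lc].
have dd u u' x : U x -> derivable f x u /\ derivable ('D_u f) x u'.
  by move=> Ux; split; apply: diff_derivable; [exact: fd|exact: (f1 u).1].
have := @norm_hausdorff R R; rewrite open_hausdorff => /(_ _ _ ne)[[A B]].
rewrite /= !inE => -[Aa Ba] [oA oB AB0].
have nA : nbhs a [set x | A (l ('D_w ('D_v f) x))].
  exact: cl v w _ (open_nbhs_nbhs (conj oA Aa)).
have nB : nbhs a [set x | B (l ('D_v ('D_w f) x))].
  exact: cl w v _ (open_nbhs_nbhs (conj oB Ba)).
have nU : nbhs a U by apply: open_nbhs_nbhs.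
pose N := U `&` ([set x | A (l ('D_w ('D_v f) x))] `&`
                [set x | B (l ('D_v ('D_w f) x))]).
have nN : nbhs a N by apply: filterI nU (filterI nA nB).
have [t t0 tN] := nbhs_parallelogram v w nN.
have tN' r s : r \in `[0, t]%R -> s \in `[0, t]%R -> N (a + r *: w + s *: v).
  by move=> rt st; rewrite addrAC; exact: tN.
have [|r [s [rt st E1]]] := @second_difference l f a v w t lc t0.
  by move=> r s rt st; apply: dd; case: (tN r s rt st).
have [|r' [s' [rt' st' E2]]] := @second_difference l f a w v t lc t0.
  by move=> r' s' rt' st'; apply: dd; case: (tN' r' s' rt' st').
have E : l ('D_w ('D_v f) (a + r *: v + s *: w)) =
         l ('D_v ('D_w f) (a + r' *: w + s' *: v)).
  apply: (mulfI (lt0r_neq0 t0)); apply: (mulfI (lt0r_neq0 t0)).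
  by rewrite -E1 -E2 (addrAC a); ring.
have [_ [rsA _]] := tN r s rt st.
have [_ [_ rsB]] := tN' r' s' rt' st'.
suff : (set0 : set R) (l ('D_w ('D_v f) (a + r *: v + s *: w))) by [].
by rewrite -AB0; split; [exact: rsA|rewrite E; exact: rsB].
Qed.

End MixedDerivatives.

Section SymmetricPartials.
Context {R : realType} {m : nat}.

(** What the Leibniz rule for the Poisson bracket uses of a function at a point:
    a condition on partial derivatives only, so that for a momentum function it
    can be read off from the formulas for its partials. *)
Definition C2_partials (f : 'rV[R]_m -> R) (z : 'rV[R]_m) : Prop :=
  (forall a b, derivable (pderiv a f) z (delta_mx 0 b)) /\
  (forall a b, pderiv b (pderiv a f) z = pderiv a (pderiv b f) z).

Lemma Ck_C2_partials (U : set 'rV[R]_m) (f : 'rV[R]_m -> R) z :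
  open U -> Ck 2 U f -> U z -> C2_partials f z.
Proof.
move=> oU fU Uz; split=> a b.
  by apply: diff_derivable; case: fU => _ /(_ (delta_mx 0 a))[+ _]; exact.
by apply: (@derive_symmetric _ _ _ idfun _ U) => // x; exact: cvg_id.
Qed.

Lemma derive_symmetric_row n (U : set 'rV[R]_m) (f : 'rV[R]_m -> 'rV[R]_n)
    z v w :
  open U -> Ck 2 U f -> U z -> 'D_w ('D_v f) z = 'D_v ('D_w f) z.
Proof.
move=> oU fU Uz; apply/rowP => j.
have @l : {linear 'rV[R]_n -> R}.
  by exists (fun N : 'rV[R]_n => N 0 j); do 2![eexists]; do ?[constructor];
     rewrite ?mxE// => ? *; rewrite ?mxE//; move=> ?; rewrite !mxE.
exact: (@derive_symmetric _ _ _ l _ U _ v w (@coord_continuous _ _ _ _ _)).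
Qed.

(** Only W is replaced by a local copy: in the application W is the complete
    lift, which agrees with a Hamiltonian vector field only over the chart. *)
Lemma lie_bracket_near (V W W' : 'rV[R]_m -> 'rV[R]_m) (z : 'rV[R]_m) :
  {near z, W =1 W'} -> lie_bracket V W z = lie_bracket V W' z.
Proof.
move=> WW'; apply/rowP => i; rewrite !mxE; congr (_ - _).
  apply: eq_bigr => j _; congr (_ * _); apply: near_eq_derive.
  by apply: filterS WW' => y ->.
by apply: eq_bigr => j _; rewrite (nbhs_singleton WW').
Qed.

End SymmetricPartials.

(** * Hamiltonian vector fields and the Poisson bracket *)

Section Hamiltonian.
Context {R : realType} {n : nat}.
Implicit Types (f h : 'rV[R]_(n + n) -> R) (z : 'rV[R]_(n + n)).

Lemma hamiltonian_vf_apply f h z : vf_apply (hamiltonian_vf f) h z =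
  \sum_k (pderiv (rshift n k) f z * pderiv (lshift n k) h z
          - pderiv (lshift n k) f z * pderiv (rshift n k) h z).
Proof.
rewrite /vf_apply big_split_ord/= -big_split/=; apply: eq_bigr => k _.
by rewrite /hamiltonian_vf row_mxEl row_mxEr !mxE mulNr.
Qed.

(** rho_f(h) is the Poisson bracket {h, f}: this is the Leibniz rule
    @{h, f} = {@h, f} + {h, @f}, rewritten with {h, @f} = - {@f, h}. *)
Lemma pderiv_hamiltonian_vf_apply f h z a :
  C2_partials f z -> C2_partials h z ->
  pderiv a (vf_apply (hamiltonian_vf f) h) z =
  vf_apply (hamiltonian_vf f) (pderiv a h) z
  - vf_apply (hamiltonian_vf h) (pderiv a f) z.
Proof.
move=> [df sf] [dh sh].
(* As a sum of pointwise products of functions, to which the rules of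
   differentiation apply. *)
have -> : vf_apply (hamiltonian_vf f) h =
  \sum_k (pderiv (rshift n k) f * pderiv (lshift n k) h
          - pderiv (lshift n k) f * pderiv (rshift n k) h).
  by apply/funext => x; rewrite hamiltonian_vf_apply fct_sumE.
have dM (c d : 'I_(n + n)) :
    derivable (pderiv c f * pderiv d h) z (delta_mx 0 a).
  exact: derivableM (df c a) (dh d a).
have eM (c d : 'I_(n + n)) : 'D_(delta_mx 0 a) (pderiv c f * pderiv d h) z =
    pderiv c f z * pderiv d (pderiv a h) z
    + pderiv d h z * pderiv c (pderiv a f) z.
  by rewrite (deriveM (df c a) (dh d a)) (sf a c) (sh a d).
rewrite {1}/pderiv derive_sum => [|k]; last exact: derivableB (dM _ _) (dM _ _).
rewrite !hamiltonian_vf_apply -sumrB; apply: eq_bigr => k _.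
rewrite (deriveB (dM (rshift n k) (lshift n k)) (dM (lshift n k) (rshift n k))).
by rewrite !eM opprB opprD addrACA.
Qed.

Lemma lie_bracket_hamiltonian_vf f h z :
  C2_partials f z -> C2_partials h z ->
  lie_bracket (hamiltonian_vf h) (hamiltonian_vf f) z =
  - hamiltonian_vf (vf_apply (hamiltonian_vf f) h) z.
Proof.
move=> Cf Ch.
have ham_l g i : (fun y => hamiltonian_vf g y 0 (lshift n i)) =
    pderiv (rshift n i) g.
  by apply/funext => y; rewrite /hamiltonian_vf row_mxEl mxE.
have ham_r g i : (fun y => hamiltonian_vf g y 0 (rshift n i)) =
    - pderiv (lshift n i) g.
  by apply/funext => y; rewrite /hamiltonian_vf row_mxEr mxE.
have vfN (U : 'rV[R]_(n + n) -> 'rV[R]_(n + n)) g i : C2_partials g z ->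
    vf_apply U (- pderiv i g) z = - vf_apply U (pderiv i g) z.
  move=> [dg _]; rewrite /vf_apply -sumrN; apply: eq_bigr => k _.
  by rewrite {1}/pderiv deriveN ?mulrN//; exact: dg.
apply/rowP => i; rewrite !mxE; case: (split_ordP i) => k ->.
  by rewrite !ham_l mxE pderiv_hamiltonian_vf_apply// opprB.
by rewrite !ham_r !vfN// mxE pderiv_hamiltonian_vf_apply// !opprK addrC.
Qed.

End Hamiltonian.

(** * Complete lifts as Hamiltonian vector fields *)

Section Momentum.
Context {R : realType} {n : nat}.
Implicit Types (G X : 'rV[R]_n -> 'rV[R]_n) (z : 'rV[R]_(n + n)).

Definition momentum G z : R := \sum_j rsubmx z 0 j * G (lsubmx z) 0 j.

Lemma is_derive_base_coord G z v j : differentiable G (lsubmx z) ->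
  is_derive z v (fun y => G (lsubmx y) 0 j) (('D_(lsubmx v) G (lsubmx z)) 0 j).
Proof.
move=> dG.
have dl : differentiable (lsubmx : 'rV[R]_(n + n) -> _) z.
  exact: differentiable_lsubmx.
have dGl := differentiable_comp dl dG.
have dGv : derivable (G \o lsubmx) z v by exact: diff_derivable.
apply: DeriveDef; first exact: (derivable_mxP _ _ _).1 dGv 0 j.
have := derive_mx dGv; rewrite (deriveE _ dGl) (diff_comp dl dG) /=.
rewrite (diff_lin z (@continuous_lsubmx R 1 n n)).
by rewrite -(deriveE _ dG) => ->; rewrite mxE.
Qed.

Lemma is_derive_fiber_coord z v j :
  is_derive z v (fun y : 'rV[R]_(n + n) => rsubmx y 0 j) (rsubmx v 0 j).
Proof.
have dr : differentiable (rsubmx : 'rV[R]_(n + n) -> _) z.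
  exact: differentiable_rsubmx.
have drv : derivable (rsubmx : 'rV[R]_(n + n) -> _) z v.
  exact: diff_derivable.
apply: DeriveDef; first exact: (derivable_mxP _ _ _).1 drv 0 j.
have := derive_mx drv; rewrite (deriveE _ dr).
by rewrite (diff_lin z (@continuous_rsubmx R 1 n n)) => ->; rewrite mxE.
Qed.

Lemma is_derive_momentum G z v : differentiable G (lsubmx z) ->
  is_derive z v (momentum G)
    (\sum_j (rsubmx z 0 j * ('D_(lsubmx v) G (lsubmx z)) 0 j
             + G (lsubmx z) 0 j * rsubmx v 0 j)).
Proof.
move=> dG.
have -> : momentum G = \sum_j ((fun y => rsubmx y 0 j)
                               * (fun y => G (lsubmx y) 0 j)).
  by apply/funext => y; rewrite fct_sumE.
apply: is_derive_sum => j.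
exact: is_deriveM (is_derive_fiber_coord z v j) (is_derive_base_coord v j dG).
Qed.

Lemma lsubmx_deltal (i : 'I_n) :
  lsubmx (delta_mx 0 (lshift n i) : 'rV[R]_(n + n)) = delta_mx 0 i.
Proof. by apply/rowP => k; rewrite !mxE eq_lshift. Qed.

Lemma rsubmx_deltal (i : 'I_n) :
  rsubmx (delta_mx 0 (lshift n i) : 'rV[R]_(n + n)) = 0.
Proof. by apply/rowP => k; rewrite !mxE eq_rlshift andbF. Qed.

Lemma lsubmx_deltar (i : 'I_n) :
  lsubmx (delta_mx 0 (rshift n i) : 'rV[R]_(n + n)) = 0.
Proof. by apply/rowP => k; rewrite !mxE eq_lrshift andbF. Qed.

Lemma rsubmx_deltar (i : 'I_n) :
  rsubmx (delta_mx 0 (rshift n i) : 'rV[R]_(n + n)) = delta_mx 0 i.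
Proof. by apply/rowP => k; rewrite !mxE eq_rshift. Qed.

Lemma pderiv_momentuml G z i : differentiable G (lsubmx z) ->
  pderiv (lshift n i) (momentum G) z = momentum ('D_(delta_mx 0 i) G) z.
Proof.
move=> dG; have [_] := is_derive_momentum (delta_mx 0 (lshift n i)) dG.
rewrite /pderiv => ->; apply: eq_bigr => j _.
by rewrite lsubmx_deltal rsubmx_deltal [X in _ + _ * X]mxE mulr0 addr0.
Qed.

Lemma pderiv_momentumr G z i : differentiable G (lsubmx z) ->
  pderiv (rshift n i) (momentum G) z = G (lsubmx z) 0 i.
Proof.
move=> dG; have [_] := is_derive_momentum (delta_mx 0 (rshift n i)) dG.
rewrite /pderiv => ->; rewrite (bigD1 i)//= big1 ?addr0 => [|j ji].
  rewrite lsubmx_deltar rsubmx_deltar derive0 [X in _ * X + _]mxE.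
  by rewrite [delta_mx _ _ _ _]mxE !eqxx mulr0 add0r mulr1.
rewrite lsubmx_deltar rsubmx_deltar derive0 [X in _ * X + _]mxE.
by rewrite [delta_mx _ _ _ _]mxE (negbTE ji) andbF !mulr0 addr0.
Qed.

Lemma complete_lift_hamiltonian X z : differentiable X (lsubmx z) ->
  complete_lift X z = hamiltonian_vf (momentum X) z.
Proof.
move=> dX; congr row_mx; apply/rowP => i; rewrite mxE.
  by rewrite pderiv_momentumr.
rewrite mxE pderiv_momentuml//; congr (- _); apply: eq_bigr => j _.
have dXi : derivable X (lsubmx z) (delta_mx 0 i) by exact: diff_derivable.
by rewrite (derive_mx dXi) [X in _ = _ * X]mxE.
Qed.

(** The momentum function is linear in p, so its second partials involve second
    derivatives of X in the base directions only, and first derivatives in the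
    mixed directions. *)
Section MomentumC2.
Variables (U : set 'rV[R]_n) (X : 'rV[R]_n -> 'rV[R]_n).
Hypotheses (oU : open U) (XU : Ck 2 U X).

Let near_lsubmx z : U (lsubmx z) -> \near z, U (lsubmx z).
Proof.
by move=> Uz; apply: (@continuous_lsubmx R 1 n n z); exact: open_nbhs_nbhs.
Qed.

Let near_pderivl z i : U (lsubmx z) ->
  {near z, momentum ('D_(delta_mx 0 i) X) =1 pderiv (lshift n i) (momentum X)}.
Proof.
move=> /near_lsubmx; apply: filterS => y Uy.
by rewrite pderiv_momentuml//; exact: XU.1.
Qed.

Let near_pderivr z i : U (lsubmx z) ->
  {near z, (fun y => X (lsubmx y) 0 i) =1 pderiv (rshift n i) (momentum X)}.
Proof.
move=> /near_lsubmx; apply: filterS => y Uy.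
by rewrite pderiv_momentumr//; exact: XU.1.
Qed.

Lemma C2_partials_momentum z : U (lsubmx z) -> C2_partials (momentum X) z.
Proof.
move=> Uz; have dX := XU.1 _ Uz.
have dDX i : differentiable ('D_(delta_mx 0 i) X) (lsubmx z).
  exact: (XU.2 (delta_mx 0 i)).1.
split=> a b.
  case: (split_ordP a) => i ->.
    apply: (near_eq_derivable (near_pderivl i Uz)).
    by have [] := is_derive_momentum (delta_mx 0 b) (dDX i).
  apply: (near_eq_derivable (near_pderivr i Uz)).
  by have [] := is_derive_base_coord (delta_mx 0 b) i dX.
have El i c : pderiv c (pderiv (lshift n i) (momentum X)) z =
    pderiv c (momentum ('D_(delta_mx 0 i) X)) z.
  by apply: near_eq_derive; apply: filterS (near_pderivl i Uz) => y ->.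
have Er i c : pderiv c (pderiv (rshift n i) (momentum X)) z =
    ('D_(lsubmx (delta_mx 0 c)) X (lsubmx z)) 0 i.
  have [_ <-] := is_derive_base_coord (delta_mx 0 c) i dX.
  by apply: near_eq_derive; apply: filterS (near_pderivr i Uz) => y ->.
case: (split_ordP a) => i ->; case: (split_ordP b) => k ->.
- rewrite (El i (lshift n k)) (El k (lshift n i)).
  rewrite (pderiv_momentuml k (dDX i)) (pderiv_momentuml i (dDX k)) /momentum.
  have := derive_symmetric_row (delta_mx 0 i) (delta_mx 0 k) oU XU Uz.
  by move=> ->.
- rewrite (El i (rshift n k)) (Er k (lshift n i)).
  by rewrite (pderiv_momentumr _ (dDX _)) lsubmx_deltal.
- rewrite (Er i (lshift n k)) (El k (rshift n i)).
  by rewrite (pderiv_momentumr _ (dDX _)) lsubmx_deltal.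
- rewrite (Er i (rshift n k)) (Er k (rshift n i)).
  by rewrite !lsubmx_deltar !derive0 !mxE.
Qed.

End MomentumC2.

End Momentum.

(** * Induced charts *)

Lemma slit_dom_open (R : realType) (n : nat) (M : manifold R n)
  (i : atlas_index M) : open (slit_dom i).
Proof.
apply: openI.
  apply: (@open_comp _ _ lsubmx (chart_cod (atlas i))) => [z _|].
    exact: (@continuous_lsubmx R 1 n n).
  exact: chart_cod_open.
apply: (@open_comp _ _ rsubmx [set p | p != 0]) => [z _|].
  exact: (@continuous_rsubmx R 1 n n).
rewrite (_ : [set p | p != 0] = ~` [set 0]); last first.
  by apply/seteqP; split=> p /eqP.
apply: closed_openC; apply: accessible_closed_set1.
exact/hausdorff_accessible/norm_hausdorff.
Qed.

Theorem proposition6 (R : realType) (n : nat) (M : manifold R n)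
    (H : cotangent_bundle M -> R) (hH : hamilton_space H)
    (X : forall x : M, tangent M x) (hX : smooth_vf X)
    (hclosed : closed1 (fun i => lie_derivative1 (clift X i) liouville))
    (hXH : vanishes (fun i => ext_d0 (vf_apply (clift X i) (fun_coord H i)))) :
  natural_infinitesimal_symmetry H X.
Proof.
move=> i z zi.
have oS := @slit_dom_open _ _ _ i.
have oC : open (chart_cod (atlas i)) by exact: chart_cod_open.
set h := fun_coord H i; set F := momentum (vf_coord X i).
have nz : nbhs z (slit_dom i) by exact: open_nbhs_nbhs.
(* The momentum description of the lift is valid over the chart, hence near z,
   which is enough for brackets and derivatives. *)
have liftE : {near z, clift X i =1 hamiltonian_vf F}.
  apply: filterS nz => y [yC _]; apply: complete_lift_hamiltonian.
  exact: (hX i 1%N).1.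
have CF : C2_partials F z := C2_partials_momentum oC (hX i 2%N) zi.1.
have Ch : C2_partials h z := Ck_C2_partials oS (ham_smooth hH i 2%N) zi.
have dFh a : pderiv a (vf_apply (hamiltonian_vf F) h) z = 0.
  have /rowP/(_ a) := hXH i z zi; rewrite !mxE => <-.
  apply: near_eq_derive; apply: filterS liftE => y yE.
  by apply: eq_bigr => j _; rewrite yE.
rewrite (lie_bracket_near _ liftE) lie_bracket_hamiltonian_vf//.
apply/eqP; rewrite oppr_eq0; apply/eqP/rowP => j.
by rewrite mxE; case: (split_ordP j) => k ->;
  rewrite ?row_mxEl ?row_mxEr !mxE dFh ?oppr0.
Qed.
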